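(* Let $M$ be a positive integer, and let $U^n\in\mathbb{R}^N$, $Q_1^n,Q_2^n\in\mathbb{R}$, $n=0,1,\dots,M$, satisfy the initial conditions $$U_j^0=u_0(x_j),\quad Q_1^0=\sqrt{\langle g(U^0,D_1U^0),\mathbf{1}\rangle_h+C_1},\quad Q_2^0=\sqrt{\langle h(U^0,D_1U^0),\mathbf{1}\rangle_h+C_2},$$ and, for every $n=0,1,\dots,M-1$, the scheme $$\begin{aligned} &\delta_tU^n=D\Big(-\mathcal{G}_1(W^n)\,Q_1^{n+\frac12}+\mathcal{G}_2(W^n)\,Q_2^{n+\frac12}+\tfrac14\big(U^{n+\frac12}-D_2U^{n+\frac12}\big)\Big),\\ &\delta_tQ_1^n=\big\langle\mathcal{G}_1(W^n),\delta_tU^n\big\rangle_h,\\ &\delta_tQ_2^n=\big\langle\mathcal{G}_2(W^n),\delta_tU^n\big\rangle_h, \end{aligned}$$ where $W^n=\hat U^{n+\frac12}=\frac{3U^n-U^{n-1}}{2}$ for $n=1,\dots,M-1$, $W^0=U^0$, and $$\mathcal{G}_1(W)=\frac{g_1(W,D_1W)-D_1g_2(W,D_1W)}{2\sqrt{\langle g(W,D_1W),\mathbf{1}\rangle_h+C_1}},\qquad \mathcal{G}_2(W)=\frac{h_1(W,D_1W)-D_1h_2(W,D_1W)}{2\sqrt{\langle h(W,D_1W),\mathbf{1}\rangle_h+C_2}} .$$ Then the discrete mass $M_h^n=\langle U^n,\mathbf{1}\rangle_h$ satisfies $M_h^{n+1}=M_h^n$ for $n=0,1,2,\dots,M-1$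.
   Context: Let $a<b$, $L=b-a$, $\mu=2\pi/L$, $N$ an even positive integer, $\Delta x=L/N$, $x_j=j\,\Delta x$, $T>0$, time step $\tau=T/M$. The function $u_0:\mathbb{R}\to\mathbb{R}$ is $L$-periodic. Vectors in $\mathbb{R}^N$ are indexed by $j=0,\dots,N-1$; $\mathbf{1}=(1,\dots,1)^T\in\mathbb{R}^N$; $\langle U,V\rangle_h=\Delta x\sum_{j=0}^{N-1}U_jV_j$ (the subscript $h$ is only a label referring to the mesh size). For any sequence $(V^n)$ of vectors or scalars, $$\delta_tV^n=\frac{V^{n+1}-V^n}{\tau},\qquad V^{n+\frac12}=\frac{V^{n+1}+V^n}{2}.$$ The Fourier pseudo-spectral differentiation matrices $D_1,D_2\in\mathbb{R}^{N\times N}$ are $$(D_1)_{j,l}=\begin{cases}\frac12\mu(-1)^{j+l}\cot\big(\mu\frac{x_j-x_l}{2}\big),&j\ne l,\\0,&j=l,\end{cases}\qquad (D_2)_{j,l}=\begin{cases}\frac12\mu^2(-1)^{j+l+1}\csc^2\big(\mu\frac{x_j-x_l}{2}\big),&j\neq l,\\-\mu^2\frac{N^2+2}{12},&j=l.\end{cases}$$ Equivalently, $D_k=F_N^H\Lambda_kF_N$ with $(F_N)_{j,k}=\frac1{\sqrt N}e^{-\mathrm{i}jk2\pi/N}$, $\Lambda_1=\mathrm{i}\mu\,\mathrm{diag}[0,1,\dots,\frac N2-1,0,1-\frac N2,\dots,-1]$, $\Lambda_2=-\mu^2\,\mathrm{diag}[0^2,1^2,\dots,(\frac N2)^2,(-\frac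 N2+1)^2,\dots,(-1)^2]$. Set $D=(I-D_2)^{-1}D_1$, with $I$ the identity matrix. The scalar functions, applied componentwise to pairs of vectors, are $$g(u,v)=(u+\tfrac12)^2(u^2+v^2),\quad g_1(u,v)=\tfrac{\partial g}{\partial u}=2(u+\tfrac12)(2u^2+v^2+\tfrac12u),\quad g_2(u,v)=\tfrac{\partial g}{\partial v}=2v(u+\tfrac12)^2,$$ $$h(u,v)=u^2(u^2+v^2),\quad h_1(u,v)=\tfrac{\partial h}{\partial u}=4u^3+2uv^2,\quad h_2(u,v)=\tfrac{\partial h}{\partial v}=2vu^2.$$ $C_1,C_2$ are real constants large enough that all quantities under the square roots in the scheme are positive. *)

(* Defs.v *)
From HB Require Import structures.
From mathcomp Require Import all_boot all_order all_algebra.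
From mathcomp Require Import all_classical all_reals all_analysis.

Set Implicit Arguments.
Unset Strict Implicit.
Unset Printing Implicit Defensive.

Import Order.TTheory GRing.Theory Num.Theory.
Import numFieldNormedType.Exports.

Local Open Scope ring_scope.

(* The domain [a, b] enters only through its length L := b - a: the mesh is
   x_j = j L / N, without a shift by a. *)

Definition mu (R : realType) (L : R) : R := 2 * pi / L.

Definition mesh_size (R : realType) (L : R) (N : nat) : R := L / N%:R.

Definition mesh_point (R : realType) (L : R) (N j : nat) : R :=
  j%:R * mesh_size L N.

Definition iprod (R : realType) (L : R) (N : nat) (U V : 'cV[R]_N) : R :=
  mesh_size L N * \sum_(j < N) U j 0 * V j 0.

Definition delta_t (R : realType) (V : lmodType R) (tau : R)
  (s : nat -> V) (n : nat) : V := tau^-1 *: (s n.+1 - s n).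

Definition midpoint (R : realType) (V : lmodType R)
  (s : nat -> V) (n : nat) : V := 2^-1 *: (s n.+1 + s n).

Definition cot (R : realType) (x : R) : R := cos x / sin x.

Definition csc (R : realType) (x : R) : R := (sin x)^-1.

Definition D1 (R : realType) (L : R) (N : nat) : 'M[R]_N :=
  \matrix_(j, l)
    if j == l then 0
    else 2^-1 * mu L * (-1) ^+ (j + l)
         * cot (mu L * ((mesh_point L N j - mesh_point L N l) / 2)).

Definition D2 (R : realType) (L : R) (N : nat) : 'M[R]_N :=
  \matrix_(j, l)
    if j == l then - (mu L ^+ 2 * ((N%:R ^+ 2 + 2) / 12))
    else 2^-1 * mu L ^+ 2 * (-1) ^+ (j + l + 1)
         * csc (mu L * ((mesh_point L N j - mesh_point L N l) / 2)) ^+ 2.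

(* For 0 < L and N even and positive, D2 is symmetric with nonpositive
   eigenvalues, so 1%:M - D2 is invertible and invmx is its actual inverse. *)
Definition Dmx (R : realType) (L : R) (N : nat) : 'M[R]_N :=
  invmx (1%:M - D2 L N) *m D1 L N.

Definition g (R : realType) (u v : R) : R :=
  (u + 2^-1) ^+ 2 * (u ^+ 2 + v ^+ 2).

(* g1, g2 (resp. h1, h2) are the partial derivatives of g (resp. h). *)
Definition g1 (R : realType) (u v : R) : R :=
  2 * (u + 2^-1) * (2 * u ^+ 2 + v ^+ 2 + 2^-1 * u).

Definition g2 (R : realType) (u v : R) : R := 2 * v * (u + 2^-1) ^+ 2.

Definition h (R : realType) (u v : R) : R := u ^+ 2 * (u ^+ 2 + v ^+ 2).

Definition h1 (R : realType) (u v : R) : R := 4 * u ^+ 3 + 2 * u * v ^+ 2.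

Definition h2 (R : realType) (u v : R) : R := 2 * v * u ^+ 2.

(* <f(W, D1 W), 1>_h + C : the quantity under the square roots. *)
Definition radicand (R : realType) (L : R) (N : nat) (f : R -> R -> R)
  (C : R) (W : 'cV[R]_N) : R :=
  iprod L (map2_mx f W (D1 L N *m W)) (const_mx 1) + C.

Definition G1 (R : realType) (L : R) (N : nat) (C : R) (W : 'cV[R]_N)
  : 'cV[R]_N :=
  (2 * Num.sqrt (radicand L (@g R) C W))^-1
    *: (map2_mx (@g1 R) W (D1 L N *m W)
        - D1 L N *m map2_mx (@g2 R) W (D1 L N *m W)).

Definition G2 (R : realType) (L : R) (N : nat) (C : R) (W : 'cV[R]_N)
  : 'cV[R]_N :=
  (2 * Num.sqrt (radicand L (@h R) C W))^-1
    *: (map2_mx (@h1 R) W (D1 L N *m W)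
        - D1 L N *m map2_mx (@h2 R) W (D1 L N *m W)).

Definition extrapolate (R : realType) (V : lmodType R)
  (U : nat -> V) (n : nat) : V :=
  if n is n'.+1 then 2^-1 *: (3 *: U n'.+1 - U n') else U 0%N.

Definition mass (R : realType) (L : R) (N : nat) (U : 'cV[R]_N) : R :=
  iprod L U (const_mx 1).

(* Main.v *)
(* The row vector of ones is a left null vector of both differentiation
   matrices.  With theta = 2 pi (j - l) / N, the entries of D1 are combinations
   of (-1)^(j+l) sin(k theta), which sum to zero over j; those of D2 are
   combinations of (-1)^(j+l) cos(k theta), which sum to zero over j except for
   k = N/2, whose contribution cancels a multiple of the identity in D2.
   Hence 1 (I - D2) = 1, so 1 (I - D2)^-1 D1 = 1 D1 = 0, and each step of the
   scheme, being of the form D v, leaves the mass unchanged whatever v is. *)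
Require Import Defs.
From HB Require Import structures.
From mathcomp Require Import all_boot all_order all_algebra.
From mathcomp Require Import all_classical all_reals all_analysis.
From mathcomp Require Import ring lra.

Set Implicit Arguments.
Unset Strict Implicit.
Unset Printing Implicit Defensive.

Import Order.TTheory GRing.Theory Num.Theory.
Import numFieldNormedType.Exports.

Local Open Scope ring_scope.

(** * Periodicity and closed forms of trigonometric sums *)

Lemma sinD2piB (R : realType) (x : R) (p q : nat) :
  sin (x + (p%:R - q%:R) * (2 * pi)) = sin x.
Proof.
(* Adding [q] turns on the left and [p] turns on the right gives the same angle. *)
rewrite -[LHS](periodicn (@sinD2pi R) q) -[RHS](periodicn (@sinD2pi R) p).
by congr sin; ring.
Qed.

Lemma cosD2piB (R : realType) (x : R) (p q : nat) :
  cos (x + (p%:R - q%:R) * (2 * pi)) = cos x.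
Proof.
rewrite -[LHS](periodicn (@cosD2pi R) q) -[RHS](periodicn (@cosD2pi R) p).
by congr cos; ring.
Qed.

Lemma cosDnpi (R : realType) (x : R) (n : nat) :
  cos (x + n%:R * pi) = (-1) ^+ n * cos x.
Proof. by rewrite -(alternatingn (@cosDpi R)) mulr_natl. Qed.

(** Since 2 sin t cos x = sin (x + t) - sin (x - t) and x advances by 2t, the sum telescopes. *)
Lemma sum_cos_telescope (R : realType) (t c : R) (n : nat) :
  2 * sin t * \sum_(k < n) cos (k%:R * (2 * t) + c)
  = sin (n%:R * (2 * t) + c - t) - sin (c - t).
Proof.
elim: n => [|n IH]; first by rewrite big_ord0 mul0r add0r subrr mulr0.
rewrite big_ord_recr /= mulrDr {}IH.
have -> : n.+1%:R * (2 * t) + c - t = n%:R * (2 * t) + c + t.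
  by rewrite -natr1; ring.
by rewrite !(sinB (n%:R * (2 * t) + c)) !(sinD (n%:R * (2 * t) + c)); ring.
Qed.

(** The [n] steps of 2t make a whole number of turns, so the two ends of the telescoped sum cancel.
    The difference [p - q] allows turns of either sign. *)
Lemma sum_cos_eq0 (R : realType) (t c : R) (n p q : nat) :
  sin t != 0 -> n%:R * t = (p%:R - q%:R) * pi ->
  \sum_(k < n) cos (k%:R * (2 * t) + c) = 0.
Proof.
move=> st0 nt; apply/eqP.
have := sum_cos_telescope t c n.
have -> : n%:R * (2 * t) + c - t = c - t + (p%:R - q%:R) * (2 * pi).
  by rewrite mulrCA nt; ring.
rewrite sinD2piB subrr => /eqP.
by rewrite !mulf_eq0 pnatr_eq0 (negPf st0).
Qed.

(** Summation by parts: 2 sin t sin (2kt) = cos (2kt - t) - cos (2kt + t), and the weights k have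
    constant difference 1. *)
Lemma sum_natM_sin (R : realType) (t : R) (n : nat) :
  2 * sin t * \sum_(k < n) k%:R * sin (k%:R * (2 * t))
  = \sum_(k < n) cos (k%:R * (2 * t) + t) - n%:R * cos (n%:R * (2 * t) - t).
Proof.
elim: n => [|n IH]; first by rewrite !big_ord0; ring.
rewrite !big_ord_recr /= mulrDr {}IH.
have -> : n.+1%:R * (2 * t) - t = n%:R * (2 * t) + t by rewrite -natr1; ring.
by rewrite -natr1 cosB cosD; ring.
Qed.

(* The weights [k * (a - k)] have constant second difference [-2]; for
   [a = n = N] they vanish at both ends of a period. *)
Lemma sum_parabola_cos (R : realType) (t a : R) (n : nat) :
  2 * (1 - cos t) * \sum_(k < n) k%:R * (a - k%:R) * cos (k%:R * t)
  = 2 * (\sum_(k < n) cos (k%:R * t))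
    + n%:R * (a - n%:R) * cos (n%:R * t - t)
    - (n%:R - 1) * (a - n%:R + 1) * cos (n%:R * t) - (a + 1).
Proof.
elim: n => [|n IH].
  by rewrite !big_ord0 !mul0r cos0; ring.
rewrite !big_ord_recr /= mulrDr {}IH.
have -> : n.+1%:R * t - t = n%:R * t by rewrite -natr1; ring.
have -> : n.+1%:R * t = n%:R * t + t by rewrite -natr1; ring.
by rewrite -natr1 cosB cosD; ring.
Qed.

(** * Non-vanishing of sine and cosine at grid angles *)

Lemma sin_ratpi_neq0 (R : realType) (N i j : nat) :
  (i < N)%N -> (j < N)%N -> i != j ->
  sin ((i%:R - j%:R) * (pi / N%:R)) != 0 :> R.
Proof.
wlog ltji : i j / (j < i)%N => [hw iN jN nij|iN _ _].
  have [/hw->//|ltij|eij] := ltngtP j i; last by rewrite eij eqxx in nij.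
  by rewrite -opprB mulNr sinN oppr_eq0 hw // eq_sym.
have N0 : 0 < N%:R :> R by rewrite ltr0n (leq_ltn_trans _ iN).
have pi0 := pi_gt0 R.
apply/lt0r_neq0/sin_gt0_pi/andP; split.
  by rewrite mulr_gt0 ?divr_gt0 // subr_gt0 ltr_nat.
rewrite mulrA ltr_pdivrMr // mulrC ltr_pM2l //.
by rewrite ltrBlDr -natrD ltr_nat ltn_addr.
Qed.

Lemma cos_ratpi_neq0 (R : realType) (N k : nat) :
  (k < N)%N -> k.*2 != N -> cos (k%:R * (pi / N%:R)) != 0 :> R.
Proof.
move=> kN k2N.
have N0 : 0 < N%:R :> R by rewrite ltr0n (leq_ltn_trans _ kN).
have pi0 := pi_gt0 R.
(* As [cos] is injective on [0, pi], a zero would force k pi / N = pi / 2, that is 2k = N. *)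
rewrite -cos_pihalf (inj_in_eq (@cos_inj R)); first last.
- by rewrite in_itv /=; lra.
- rewrite in_itv /=; apply/andP; split.
    by rewrite mulr_ge0 ?ler0n // divr_ge0 // ltW.
  by rewrite mulrA ler_pdivrMr // mulrC ler_pM2l // ler_nat ltnW.
apply: contra k2N => /eqP e; rewrite -(eqr_nat R) -mul2n natrM.
have e2 : k%:R * pi = N%:R / 2 * pi :> R.
  by rewrite -[LHS](@divfK _ N%:R) ?lt0r_neq0 // -[X in X * _]mulrA e; field.
by rewrite (mulIf (lt0r_neq0 pi0) e2) mulrC divfK.
Qed.

(** * Alternating sums over the grid *)

Lemma natr_half (R : numFieldType) (n : nat) :
  ~~ odd n -> n./2%:R = n%:R / 2 :> R.
Proof.
by move=> evn; rewrite -[in RHS](even_halfK evn) -muln2 natrM mulfK.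
Qed.

(* The sign [(-1) ^+ j] is itself the mode of index [N / 2], so only [k = N / 2]
   survives. *)
Lemma alt_sum_cos (R : realType) (N k : nat) (c : R) :
  ~~ odd N -> (k < N)%N ->
  \sum_(j < N) (-1) ^+ j * cos (j%:R * (2 * (k%:R * (pi / N%:R))) + c)
  = (k.*2 == N)%:R * (N%:R * cos c).
Proof.
move=> evN kN.
have N0 : N%:R != 0 :> R by rewrite pnatr_eq0 -lt0n (leq_ltn_trans _ kN).
have [k2N|k2N] := eqVneq.
  have kE : k%:R = N%:R / 2 :> R by rewrite -k2N -muln2 natrM; field.
  rewrite mul1r.
  transitivity (\sum_(j < N) cos c); first last.
    by rewrite sumr_const card_ord mulr_natl.
  apply: eq_bigr => j _.
  have -> : j%:R * (2 * (k%:R * (pi / N%:R))) + c = c + j%:R * pi :> R.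
    by rewrite kE; field.
  by rewrite cosDnpi mulrA -exprMn mulrNN mulr1 expr1n mul1r.
rewrite mul0r.
(* The sign (-1)^j is absorbed as a phase j pi, which adds pi / 2 to t; then N t = (k + N/2) pi and
   sin t = cos (k pi / N). *)
rewrite -[RHS](@sum_cos_eq0 R (k%:R * (pi / N%:R) + pi / 2) c N (k + N./2) 0).
- by apply: eq_bigr => j _; rewrite -cosDnpi; congr cos; field.
- by rewrite sinDpihalf cos_ratpi_neq0.
- by rewrite subr0 natrD natr_half //; field.
Qed.

(** Half of theta = 2 pi (j - l) / N: the argument of [cot] and [csc] in [D1] and [D2], from which
    [L] cancels. *)
Definition half_angle (R : realType) (N j l : nat) : R :=
  (j%:R - l%:R) * (pi / N%:R).

Lemma alt_sum_cosB (R : realType) (N k l : nat) :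
  ~~ odd N -> (k < N)%N ->
  \sum_(j < N) (-1) ^+ (j + l) * cos (k%:R * (2 * half_angle R N j l))
  = (k.*2 == N)%:R * N%:R.
Proof.
move=> evN kN.
have N0 : N%:R != 0 :> R by rewrite pnatr_eq0 -lt0n (leq_ltn_trans _ kN).
pose c : R := - (l%:R * (2 * (k%:R * (pi / N%:R)))).
transitivity ((-1) ^+ l * ((k.*2 == N)%:R * (N%:R * cos c))).
  rewrite -alt_sum_cos // mulr_sumr; apply: eq_bigr => j _.
  rewrite exprD -mulrA mulrCA; congr (_ * (_ * cos _)).
  by rewrite /half_angle /c; ring.
have [k2N|_] := eqVneq; last by rewrite !mul0r mulr0.
have kE : k%:R = N%:R / 2 :> R by rewrite -k2N -muln2 natrM; field.
rewrite !mul1r /c cosN.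
(* At k = N/2 the phase is l pi, whose sign cancels the factor (-1)^l. *)
have -> : l%:R * (2 * (k%:R * (pi / N%:R))) = 0 + l%:R * pi :> R.
  by rewrite kE; field.
rewrite cosDnpi cos0 mulr1 mulrCA -exprD addnn -mul2n exprM.
by rewrite sqrrN !expr1n mulr1.
Qed.

(** A sine is a cosine delayed by pi / 2; at the only surviving index k = N/2 the phase is an odd
    multiple of pi / 2, where the cosine vanishes. *)
Lemma alt_sum_sinB (R : realType) (N k l : nat) :
  ~~ odd N -> (k < N)%N ->
  \sum_(j < N) (-1) ^+ (j + l) * sin (k%:R * (2 * half_angle R N j l)) = 0.
Proof.
move=> evN kN.
have N0 : N%:R != 0 :> R by rewrite pnatr_eq0 -lt0n (leq_ltn_trans _ kN).
pose c : R := - (l%:R * (2 * (k%:R * (pi / N%:R)))) - pi / 2.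
transitivity ((-1) ^+ l * ((k.*2 == N)%:R * (N%:R * cos c))).
  rewrite -alt_sum_cos // mulr_sumr; apply: eq_bigr => j _.
  rewrite -cosBpihalf exprD -mulrA mulrCA; congr (_ * (_ * cos _)).
  by rewrite /half_angle /c; ring.
have [k2N|_] := eqVneq; last by rewrite !mul0r mulr0.
have kE : k%:R = N%:R / 2 :> R by rewrite -k2N -muln2 natrM; field.
have -> : c = - (pi / 2 + l%:R * pi) by rewrite /c kE; field.
by rewrite cosN cosDnpi cos_pihalf !mulr0.
Qed.

(** * Finite Fourier expansions of cotangent and squared cosecant *)

Lemma half_angleM (R : realType) (N j l : nat) : (0 < N)%N ->
  N%:R * half_angle R N j l = (j%:R - l%:R) * pi.
Proof.
by move=> N0; rewrite /half_angle; field; rewrite pnatr_eq0 -lt0n.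
Qed.

(** In [sum_natM_sin] over a full period the cosine sum vanishes and the boundary term reduces to N
    cos t; dividing by sin t gives the cotangent. *)
Lemma cotE (R : realType) (N j l : nat) :
  (j < N)%N -> (l < N)%N -> j != l ->
  cot (half_angle R N j l)
  = - (2 / N%:R * \sum_(k < N) k%:R * sin (k%:R * (2 * half_angle R N j l))).
Proof.
move=> jN lN njl; have N0 : (0 < N)%N by rewrite (leq_ltn_trans _ jN).
have Nn0 : N%:R != 0 :> R by rewrite pnatr_eq0 -lt0n.
have s0 : sin (half_angle R N j l) != 0 by apply: sin_ratpi_neq0.
have := sum_natM_sin (half_angle R N j l) N.
have Nt := half_angleM R j l N0.
rewrite (sum_cos_eq0 _ s0 Nt) /cot.
have -> : N%:R * (2 * half_angle R N j l) - half_angle R N j l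
          = - half_angle R N j l + (j%:R - l%:R) * (2 * pi).
  by rewrite mulrCA Nt; ring.
rewrite cosD2piB cosN; set S := \sum_(k < N) _ => e.
have -> : cos (half_angle R N j l)
          = - (2 * sin (half_angle R N j l) * S) / N%:R.
  by rewrite e; field.
by field; rewrite Nn0 s0.
Qed.

(** Over a full period [sum_parabola_cos] reduces to 4 sin(t)^2 S = -2N, because 1 - cos (2t) = 2
    sin(t)^2. *)
Lemma csc2E (R : realType) (N j l : nat) :
  (j < N)%N -> (l < N)%N -> j != l ->
  csc (half_angle R N j l) ^+ 2
  = - (2 / N%:R * \sum_(k < N) k%:R * (N%:R - k%:R)
                                * cos (k%:R * (2 * half_angle R N j l))).
Proof.
move=> jN lN njl; have N0 : (0 < N)%N by rewrite (leq_ltn_trans _ jN).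
have Nn0 : N%:R != 0 :> R by rewrite pnatr_eq0 -lt0n.
have s0 : sin (half_angle R N j l) != 0 by apply: sin_ratpi_neq0.
have := sum_parabola_cos (2 * half_angle R N j l) N%:R N.
have Nt := half_angleM R j l N0.
have := sum_cos_eq0 0 s0 Nt; under eq_bigr do rewrite addr0; move=> ->.
have -> : N%:R * (2 * half_angle R N j l) = 0 + (j%:R - l%:R) * (2 * pi).
  by rewrite mulrCA Nt; ring.
rewrite cosD2piB cos0 subrr !mulr0 mul0r !add0r.
set S := \sum_(k < N) _; set t := half_angle R N j l in s0 *.
have -> : cos (2 * t) = 1 - 2 * sin t ^+ 2.
  by rewrite mulr_natl cos_mulr2n cos2sin2; ring.
rewrite /csc => e.
have -> : S = - N%:R / (2 * sin t ^+ 2).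
  apply: (mulfI (_ : 4 * sin t ^+ 2 != 0)); first
    by rewrite mulf_neq0 ?expf_neq0 ?pnatr_eq0.
  transitivity (2 * (1 - (1 - 2 * sin t ^+ 2)) * S); first by ring.
  by rewrite e; field.
by field; rewrite Nn0 s0.
Qed.

Lemma sum_parabola (R : realType) (a : R) (n : nat) :
  \sum_(k < n) k%:R * (a - k%:R)
  = n%:R * (n%:R - 1) * (3 * a - 2 * n%:R + 1) / 6.
Proof.
elim: n => [|n IH]; first by rewrite big_ord0; ring.
by rewrite big_ord_recr /= IH -natr1; field.
Qed.

(** * Entries of the differentiation matrices as trigonometric sums *)

Lemma mesh_angle (R : realType) (L : R) (N j l : nat) : L != 0 -> (0 < N)%N ->
  mu L * ((mesh_point L N j - mesh_point L N l) / 2) = half_angle R N j l.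
Proof.
move=> L0 N0; rewrite /mu /mesh_point /mesh_size /half_angle.
by field; rewrite L0 pnatr_eq0 -lt0n N0.
Qed.

(** Splits each entry by frequency k, so that column sums become alternating sums; the diagonal fits
    because every sine vanishes there. *)
Lemma D1_spectral (R : realType) (L : R) (N : nat) (j l : 'I_N) : L != 0 ->
  D1 L N j l
  = - (mu L / N%:R * \sum_(k < N) k%:R * ((-1) ^+ (j + l)
                        * sin (k%:R * (2 * half_angle R N j l)))).
Proof.
move=> L0; have N0 : (0 < N)%N by rewrite (leq_ltn_trans _ (ltn_ord j)).
under eq_bigr do rewrite mulrCA.
rewrite mxE -mulr_sumr; have [->|njl] := eqVneq.
  rewrite big1 ?mulr0 ?oppr0 // => k _.
  by rewrite /half_angle subrr mul0r !mulr0 sin0 mulr0.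
by rewrite mesh_angle // cotE //; field; rewrite pnatr_eq0 -lt0n.
Qed.

Lemma D2_spectral (R : realType) (L : R) (N : nat) (j l : 'I_N) : L != 0 ->
  D2 L N j l
  = mu L ^+ 2 / N%:R * \sum_(k < N) k%:R * (N%:R - k%:R) * ((-1) ^+ (j + l)
                          * cos (k%:R * (2 * half_angle R N j l)))
    - (j == l)%:R * (mu L ^+ 2 * N%:R ^+ 2 / 4).
Proof.
move=> L0; have N0 : (0 < N)%N by rewrite (leq_ltn_trans _ (ltn_ord j)).
have Nn0 : N%:R != 0 :> R by rewrite pnatr_eq0 -lt0n.
under eq_bigr do rewrite mulrCA.
rewrite mxE -mulr_sumr; have [->|njl] := eqVneq.
  rewrite addnn -mul2n exprM sqrrN !expr1n.
  under eq_bigr do rewrite /half_angle subrr mul0r !mulr0 cos0 mulr1.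
  (* On the diagonal the sum gives mu^2 (N^2 - 1) / 6, which exceeds the entry -mu^2 (N^2 + 2) / 12
     by mu^2 N^2 / 4. *)
  by rewrite sum_parabola !mul1r; field.
by rewrite mesh_angle // csc2E // (exprD _ (j + l)) mul0r subr0; field.
Qed.

(** * The vector of ones as a left null vector, and conservation of mass *)

Lemma ones_D1 (R : realType) (L : R) (N : nat) : L != 0 -> ~~ odd N ->
  const_mx 1 *m D1 L N = 0 :> 'rV[R]_N.
Proof.
move=> L0 evN; apply/rowP => l; rewrite !mxE.
under eq_bigr do rewrite mxE mul1r D1_spectral //.
rewrite sumrN -mulr_sumr exchange_big /= big1 ?mulr0 ?oppr0 // => k _.
by rewrite -mulr_sumr alt_sum_sinB ?mulr0.
Qed.

Lemma ones_D2 (R : realType) (L : R) (N : nat) : L != 0 -> ~~ odd N ->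
  const_mx 1 *m D2 L N = 0 :> 'rV[R]_N.
Proof.
move=> L0 evN; apply/rowP => l; rewrite !mxE.
have N0 : (0 < N)%N by rewrite (leq_ltn_trans _ (ltn_ord l)).
have Nn0 : N%:R != 0 :> R by rewrite pnatr_eq0 -lt0n.
have hN : (N./2 < N)%N by rewrite ltn_half_double -addnn -ltn_psubLR ?subnn.
under eq_bigr do rewrite mxE mul1r D2_spectral //.
rewrite sumrB -mulr_sumr exchange_big /=.
under eq_bigr do rewrite -mulr_sumr alt_sum_cosB //.
(* Only k = N/2 survives; its weight (N/2)^2 gives mu^2 N^2 / 4, exactly the diagonal correction. *)
rewrite (bigD1 (Ordinal hN)) //= halfK (negPf evN) subn0 eqxx big1 => [|k nk].
  rewrite (bigD1 l) //= eqxx big1 => [|j /negPf->]; last by rewrite mul0r.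
  by rewrite natr_half // !mul1r; field.
case: eqP => [k2N|_]; last by rewrite mul0r mulr0.
by case/eqP: nk; apply: val_inj; rewrite /= -[LHS]doubleK k2N.
Qed.

(* Holds for every [A]: outside [unitmx], [invmx A] is [A] itself. *)
Lemma mulmx_invmx_fix (F : fieldType) (m n : nat) (u : 'M[F]_(m, n))
  (A : 'M[F]_n) : u *m A = u -> u *m invmx A = u.
Proof.
move=> uA; have [Au|nAu] := boolP (A \in unitmx); last by rewrite invmx_out.
by rewrite -{1}uA mulmxK.
Qed.

Lemma ones_Dmx (R : realType) (L : R) (N : nat) : L != 0 -> ~~ odd N ->
  const_mx 1 *m Dmx L N = 0 :> 'rV[R]_N.
Proof.
move=> L0 evN; rewrite /Dmx mulmxA mulmx_invmx_fix ?ones_D1 //.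
by rewrite mulmxBr mulmx1 ones_D2 // subr0.
Qed.

Lemma massE (R : realType) (L : R) (N : nat) (U : 'cV[R]_N) :
  mass L U = mesh_size L N * (const_mx 1 *m U : 'M[R]_1) 0 0.
Proof.
rewrite /mass /iprod mxE; congr (_ * _); apply: eq_bigr => j _.
by rewrite !mxE mulrC.
Qed.

Theorem theorem4p2 (R : realType) (a b T C1 C2 : R) (N M : nat)
  (u0 : R -> R) (U : nat -> 'cV[R]_N) (Q1 Q2 : nat -> R) :
  let L := b - a in
  let tau := T / M%:R in
  let W := extrapolate U in
  a < b -> 0 < T ->
  (0 < N)%N -> ~~ odd N -> (0 < M)%N ->
  periodic u0 L ->
  (forall n, (n < M)%N -> 0 < radicand L (@g R) C1 (W n)) ->
  (forall n, (n < M)%N -> 0 < radicand L (@h R) C2 (W n)) ->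
  (forall j : 'I_N, U 0%N j 0 = u0 (mesh_point L N j)) ->
  Q1 0%N = Num.sqrt (radicand L (@g R) C1 (U 0%N)) ->
  Q2 0%N = Num.sqrt (radicand L (@h R) C2 (U 0%N)) ->
  (forall n, (n < M)%N ->
     delta_t tau U n =
     Dmx L N *m (- (midpoint Q1 n *: G1 L C1 (W n))
                 + midpoint Q2 n *: G2 L C2 (W n)
                 + 4^-1 *: (midpoint U n - D2 L N *m midpoint U n))) ->
  (forall n, (n < M)%N ->
     delta_t tau Q1 n = iprod L (G1 L C1 (W n)) (delta_t tau U n)) ->
  (forall n, (n < M)%N ->
     delta_t tau Q2 n = iprod L (G2 L C2 (W n)) (delta_t tau U n)) ->
  forall n, (n < M)%N -> mass L (U n.+1) = mass L (U n).
Proof.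
move=> L tau W ltab T0 _ evN M0 _ _ _ _ _ _ schemeU _ _ n ltnM.
have L0 : L != 0 by rewrite subr_eq0 gt_eqF.
have tau0 : tau^-1 != 0.
  by rewrite invr_eq0 mulf_neq0 ?invr_eq0 ?pnatr_eq0 -?lt0n ?gt_eqF.
rewrite !massE; congr (_ * fun_of_matrix _ 0 0).
(* Scaling the increment by the nonzero [tau^-1] exposes [delta_t], which the scheme puts in the
   range of [Dmx]. *)
apply: subr0_eq; rewrite -mulmxBr; apply: (scalerI tau0).
rewrite scaler0 scalemxAr -/(delta_t tau U n) schemeU //.
by rewrite mulmxA ones_Dmx ?mul0mx.
Qed.
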